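(* Let $(\Omega,\mathcal{F},\mathbb{P},(\mathcal{F}_t)_{t\ge0})$ be a complete filtered probability space with right-continuous filtration. Let $\mu$ be a nonnegative Borel measure on $\mathbb{R}^+$ with $\mu(\mathbb{R}^+)\in(0,\infty)$, let $Z$ be a real-valued c\`adl\`ag semimartingale, and let $X(0)$ be a real-valued $\mathcal{F}_0$-measurable initial value. Suppose $f:\mathbb{R}\to\mathbb{R}$ is measurable and satisfies: for each $d>0$ there is $K_d>0$ such that $|f(x)-f(y)|\le K_d|x-y|$ for all $x,y\in[-d,d]$; and there are constants $K,\eta>0$ such that $|f(x)|\le K+\eta|x|$ for all $x\in\mathbb{R}$. Then there exists a unique strong solution of $$X(t)=X(0)+\mu(\{0\})\int_{[0,t]}f(X(s-))\,ds+\int_{[0,t)}m_-(t-s)f(X(s))\,ds+Z(t),\quad t\ge0,$$ where $m_-(t)=\mu((0,t])$. Moreover, with probability $1$ this solution exists for all $t\ge0$ as a real-valued process.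
   Context: $\mathbb{R}^+=[0,\infty)$ and $X(s-)$ denotes the left limit $\lim_{u\uparrow s}X(u)$. A regular process is an adapted process whose paths are right continuous with left limits. A process is $\mathbb{P}$-null if $\mathbb{P}$-almost surely its paths are identically zero. A process $X$ defined on $[0,\tau)$ is a strong solution on $[0,\tau)$ with initial value $X(0)$ if the process $\mu(\{0\})\int_{[0,t]}f(X(s-))\,ds+\int_{[0,t)}m_-(t-s)f(X(s))\,ds+Z(t)$ is well defined on $[0,\tau)$ as a regular process and differs from $X(t)-X(0)$ by a $\mathbb{P}$-null process. The solution is unique if for any two strong solutions $X,Y$ the process $X-Y$ is $\mathbb{P}$-null. *)

(* Defs.v *)
From HB Require Import structures.
From mathcomp Require Import all_boot all_order all_algebra.
From mathcomp Require Import all_classical all_reals all_analysis.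

Set Implicit Arguments.
Unset Strict Implicit.
Unset Printing Implicit Defensive.

Import Order.TTheory GRing.Theory Num.Theory.
Import numFieldNormedType.Exports.
Local Open Scope classical_set_scope.
Local Open Scope ring_scope.

(* Time is R, of which only the half-line [0, +oo[ is ever used: a filtration is
   a family F : R -> set (set T) and a process a map X : R -> T -> R, where
   F t and X t are irrelevant for t < 0.  A process on [0, tau), with
   tau : T -> \bar R, is likewise a total map whose values X t w are irrelevant
   unless 0 <= t and t%:E < tau w; tau = cst +oo gives processes on [0, +oo[. *)

Section Processes.
Context (R : realType) (d : measure_display) (T : measurableType d).
Implicit Types (F : R -> set (set T)) (G : set (set T)) (tau : T -> \bar R).
Implicit Types (X M A Z : R -> T -> R) (s t u : R) (w : T).

Definition measurable_wrt G (Y : T -> R) : Prop :=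
  forall B : set R, measurable B -> G (Y @^-1` B).

Definition filtration F : Prop :=
  (forall t, 0 <= t -> sigma_algebra setT (F t)) /\
  (forall t, 0 <= t -> F t `<=` measurable) /\
  (forall s t, 0 <= s -> s <= t -> F s `<=` F t).

(* (Omega, F, P, (F_t)) is complete, with a right-continuous filtration. *)
Definition usual_conditions (P : probability T R) F : Prop :=
  [/\ filtration F,
      measure_is_complete P,
      P.-negligible `<=` F 0 &
      forall t, 0 <= t -> \bigcap_(u in [set u | t < u]) F u = F t].

Definition stopping_time F tau : Prop :=
  (forall w, (0 <= tau w)%E) /\
  (forall t, 0 <= t -> F t [set w | (tau w <= t%:E)%E]).

(* X t is a random variable, resp. F t-measurable, on the event {t < tau}. *)
Definition process_on tau X : Prop :=
  forall t, 0 <= t -> forall B : set R, measurable B ->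
    measurable [set w | (t%:E < tau w)%E /\ B (X t w)].

Definition adapted_on F tau X : Prop :=
  forall t, 0 <= t -> forall B : set R, measurable B ->
    F t [set w | (t%:E < tau w)%E /\ B (X t w)].

Definition has_left_limits_on tau X : Prop :=
  forall w t, 0 < t -> (t%:E < tau w)%E -> cvg (X u w @[u --> t^'-]).

Definition right_continuous_on tau X : Prop :=
  forall w t, 0 <= t -> (t%:E < tau w)%E -> X u w @[u --> t^'+] --> X t w.

Definition regular_on F tau X : Prop :=
  [/\ adapted_on F tau X, right_continuous_on tau X & has_left_limits_on tau X].

Definition regular F X : Prop := regular_on F (cst +oo%E) X.

Definition null_on (P : probability T R) tau X : Prop :=
  {ae P, forall w, forall t, 0 <= t -> (t%:E < tau w)%E -> X t w = 0}.

(* Y is a version of E[ V | G ]. *)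
Definition is_cond_exp (P : probability T R) G (V Y : T -> R) : Prop :=
  [/\ measurable_wrt G Y,
      P.-integrable setT (EFin \o Y) &
      forall E, G E ->
        (\int[P]_(w in E) (Y w)%:E = \int[P]_(w in E) (V w)%:E)%E].

Definition martingale (P : probability T R) F M : Prop :=
  [/\ forall t, 0 <= t -> measurable_wrt (F t) (M t),
      forall t, 0 <= t -> P.-integrable setT (EFin \o M t) &
      forall s t, 0 <= s -> s <= t -> is_cond_exp P (F s) (M t) (M s)].

Definition stopped tau X : R -> T -> R :=
  fun t w => X (fine (Order.min t%:E (tau w))) w.

Definition local_martingale (P : probability T R) F M : Prop :=
  regular F M /\
  exists sigma : nat -> T -> \bar R,
    [/\ forall n, stopping_time F (sigma n),
        {ae P, forall w, (forall n, (sigma n w <= sigma n.+1 w)%E) /\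
                         sigma n w @[n --> \oo] --> +oo%E} &
        forall n, martingale P F (fun t w => stopped (sigma n) M t w - M 0 w)].

Definition finite_variation F A : Prop :=
  regular F A /\
  forall w t, 0 <= t -> bounded_variation 0 t (fun s => A s w).

(* Z(0) is absorbed in the finite variation part. *)
Definition cadlag_semimartingale (P : probability T R) F Z : Prop :=
  regular F Z /\
  exists M A, [/\ local_martingale P F M, finite_variation F A &
    null_on P (cst +oo%E) (fun t w => Z t w - (M t w + A t w))].

End Processes.

Section DelayEquation.
Context (R : realType) (d : measure_display) (T : measurableType d).
Implicit Types (mu : {measure set (measurableTypeR R) -> \bar R}).
Implicit Types (f : R -> R) (X Z : R -> T -> R) (tau : T -> \bar R).
Implicit Types (s t u : R) (w : T).

Definition m_minus mu (t : R) : R := fine (mu `]0, t]%classic).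

(* X(s-); the value of this at s = 0 is irrelevant, as it is only used under a
   Lebesgue integral in s. *)
Definition left_limit X (s : R) (w : T) : R := lim (X u w @[u --> s^'-]).

Definition point_integrand f X (w : T) (s : R) : R := f (left_limit X s w).

Definition delay_integrand mu f X (t : R) (w : T) (s : R) : R :=
  m_minus mu (t - s) * f (X s w).

Definition solution_rhs mu f Z X (t : R) (w : T) : R :=
  fine (mu [set 0]) *
    (\int[@lebesgue_measure R]_(s in `[0, t]) point_integrand f X w s) +
  (\int[@lebesgue_measure R]_(s in `[0, t[) delay_integrand mu f X t w s) +
  Z t w.

Definition rhs_well_defined_on mu f tau X : Prop :=
  has_left_limits_on tau X /\
  forall w t, 0 <= t -> (t%:E < tau w)%E ->
    (@lebesgue_measure R).-integrable `[0, t] (EFin \o point_integrand f X w) /\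
    (@lebesgue_measure R).-integrable `[0, t[
      (EFin \o delay_integrand mu f X t w).

(* x0 is the initial datum in the equation.  At t = 0 the equation reads
   X 0 = x0 + Z 0, so that x0 is the value of X at time 0 when Z 0 = 0. *)
Definition strong_solution (P : probability T R) (F : R -> set (set T))
    mu f Z (x0 : T -> R) tau X : Prop :=
  [/\ process_on tau X,
      rhs_well_defined_on mu f tau X,
      regular_on F tau (solution_rhs mu f Z X) &
      null_on P tau (fun t w => (X t w - x0 w) - solution_rhs mu f Z X t w)].

End DelayEquation.

(* Main.v *)
(* The noise Z enters additively, so the equation is solved path by path, for
   every outcome.  The drift at time t is at most C times the integral over
   [0, t] of any bound on |f (x s)|, and likewise for differences.  With the
   weights expR (L * t), L large, linear growth bounds all Picard iterates on
   [0, b] by one constant; the Lipschitz constant of f for that bound then makes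
   the iterates converge geometrically, uniformly on [0, b], to a cadlag
   solution, and the same contraction gives uniqueness.  For adaptedness, right
   continuous adapted processes and their left limits are jointly measurable in
   (time, outcome), so Fubini's theorem makes each Picard iterate at time t
   measurable with respect to F t. *)
Require Import Defs.
From HB Require Import structures.
From mathcomp Require Import all_boot all_order all_algebra.
From mathcomp Require Import all_classical all_reals all_analysis.
From mathcomp Require Import measurable_realfun.
From mathcomp Require Import ring lra.

Set Implicit Arguments.
Unset Strict Implicit.
Unset Printing Implicit Defensive.

Import Order.TTheory GRing.Theory Num.Theory.
Import numFieldNormedType.Exports.
Local Open Scope classical_set_scope.
Local Open Scope ring_scope.

(** * Cadlag paths: boundedness, left limits and uniform limits *)

Section CadlagPaths.
Context {R : realType}.
Implicit Types (x y : R -> R) (s t u : R).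

Definition llim x t : R := lim (x u @[u --> t^'-]).

(* Paths are defined on all of R; the paths of the theorem are extended to
   negative times by their value at 0. *)
Definition cadlag x : Prop :=
  forall t, x u @[u --> t^'+] --> x t /\ cvg (x u @[u --> t^'-]).

(** Near each time [t] the path is bounded by [|x t| + 1] on the right and by [|l| + 1] on the left,
    [l] being the left limit; compactness of [[a, b]] makes these local bounds uniform. *)
Lemma cadlag_bounded x (a b : R) : cadlag x ->
  exists2 D, 0 < D & forall s, a <= s -> s <= b -> `|x s| <= D.
Proof.
move=> cx; have := @segment_compact R a b.
rewrite compact_near_coveringP.
move=> /(_ R +oo%R (fun D s => `|x s| <= D)) [] => [t _|D [_ HD]].
  have [xr /cvg_ex[l xl]] := cx t.
  pose D := Num.max (`|x t| + 1) (`|l| + 1).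
  exists ([set u | `|x u| <= D], [set D' | D <= D']); last first.
    by move=> [u D'] [/= uD DD']; exact: le_trans DD'.
  split => /=; last exact: nbhs_pinfty_ge (num_real D).
  have Hr : \forall u \near t^'+, `|x u| < `|x t| + 1.
    by apply: (cvgr_norm_lt _ xr); rewrite ltrDl.
  have Hl : \forall u \near t^'-, `|x u| < `|l| + 1.
    by apply: (cvgr_norm_lt _ xl); rewrite ltrDl.
  rewrite /at_right /at_left !near_withinE in Hr Hl.
  near=> u; have [ut|tu|->] := ltgtP u t.
  - by rewrite /= le_max; apply/orP; right; apply: ltW; move: ut; near: u.
  - by rewrite /= le_max; apply/orP; left; apply: ltW; move: tu; near: u.
  - by rewrite /= le_max; apply/orP; left; rewrite lerDl.
(* What holds near [+oo] holds strictly beyond some [D], hence [D + 1]; the maximum with 1 makes the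
   bound positive. *)
exists (Num.max (D + 1) 1); first by rewrite lt_max ltr01 orbT.
move=> s as_ sb; rewrite le_max; apply/orP; left.
by apply: (HD (D + 1)); rewrite ?ltrDl//= in_itv/= as_ sb.
Unshelve. all: by end_near. Qed.

Lemma llim_dist_le x y t (D : R) :
  cvg (x u @[u --> t^'-]) -> cvg (y u @[u --> t^'-]) ->
  (\forall u \near t^'-, `|x u - y u| <= D) -> `|llim x t - llim y t| <= D.
Proof.
move=> cx cy Hxy.
have cn : `|x u - y u| @[u --> t^'-] --> `|llim x t - llim y t|.
  by apply: cvg_norm; apply: cvgB.
rewrite -(cvg_lim _ cn)//; apply: limr_le => //; apply/cvg_ex.
by eexists; exact: cn.
Qed.

Lemma llim_norm_le x t (D : R) :
  cvg (x u @[u --> t^'-]) ->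
  (\forall u \near t^'-, `|x u| <= D) -> `|llim x t| <= D.
Proof.
move=> cx Hx; have c0 : cvg ((fun=> 0 : R) u @[u --> t^'-]) by exact: is_cvg_cst.
have := @llim_dist_le x (fun=> 0) t D cx c0.
rewrite {2}/llim lim_cst// subr0; apply.
by near=> u; rewrite subr0; near: u.
Unshelve. all: by end_near. Qed.

(** Right continuity is a three-epsilon argument; on the left, the values of [x] are Cauchy because
    they stay close to the left limit of a single [xs n]. Asking for one approximant per [b] and [e]
    also covers paths that agree exactly with some [xs n] up to time [b]. *)
Lemma uniform_limit_cadlag (xs : nat -> R -> R) x :
  (forall n, cadlag (xs n)) ->
  (forall b e : R, 0 < e ->
    exists n, forall t, t <= b -> `|xs n t - x t| <= e) ->
  cadlag x.
Proof.
move=> cxs xsx t; split.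
  apply/cvgrPdist_le => e e0; have e3 : 0 < e / 3 by rewrite divr_gt0.
  have [n Hn] := xsx (t + 1) _ e3.
  have [/cvgrPdist_le/(_ _ e3) cr _] := cxs n t.
  near=> u.
  have -> : x t - x u = - (xs n t - x t) + (xs n t - xs n u) + (xs n u - x u).
    by rewrite opprB !addrA !subrK.
  apply: (le_trans (ler_normD _ _)).
  have -> : e = e / 3 + e / 3 + e / 3 by field.
  apply: lerD; last first.
    apply: Hn; apply: ltW; near: u; apply: nbhs_right_lt.
    by rewrite ltrDl.
  apply: (le_trans (ler_normD _ _)); rewrite normrN; apply: lerD.
    by apply: Hn; rewrite lerDl.
  by near: u.
apply: cauchy_cvg; apply: cauchy_exP => e e0.
have e3 : 0 < e / 3 by rewrite divr_gt0.
have [n Hn] := xsx t _ e3.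
have [_ /cvg_ex[l /cvgrPdist_le/(_ _ e3) cl]] := cxs n t.
exists l; change (\forall u \near t^'-, ball l e (x u)).
near=> u; rewrite -ball_normE /=.
have -> : l - x u = (l - xs n u) + (xs n u - x u) by rewrite addrA subrK.
apply: (le_lt_trans (ler_normD _ _)).
apply: (@le_lt_trans _ _ (e / 3 + e / 3)); last lra.
apply: lerD; first by near: u.
by apply: Hn; apply: ltW; near: u; exact: nbhs_left_lt.
Unshelve. all: by end_near. Qed.

End CadlagPaths.

(** * Joint measurability in time and outcome *)

Section JointMeasurability.
Context {R : realType} {d : measure_display} {T : measurableType d}.
Implicit Types (Y : R -> T -> R) (s : R).

(** The process is sampled at [phi n s], the next point after [s] on the grid of mesh [1 / (n + 1)].
    The sampled process is a fixed random variable on each of countably many time intervals, and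
    converges to [Y s] by right continuity. *)
Lemma right_continuous_measurable Y :
  (forall s, measurable_fun setT (Y s)) ->
  (forall w s, Y u w @[u --> s^'+] --> Y s w) ->
  measurable_fun setT (fun p : R * T => Y p.1 p.2).
Proof.
move=> mY rY.
pose c n : R := n.+1%:R.
have c0 n : 0 < c n by rewrite ltr0n.
(* The floor plus one, unlike the ceiling, lies strictly above [s], as the sequential criterion for
   right limits demands. *)
pose phi n s : R := (Num.floor (s * c n) + 1)%:~R / c n.
have phi_gt n s : s < phi n s by rewrite /phi ltr_pdivlMr// floorD1_gt.
have phi_le n s : phi n s <= s + harmonic n.
  rewrite /phi ler_pdivrMr// mulrDl /harmonic mulVf ?gt_eqF//.
  by rewrite intrD lerD2r floor_le.
apply: (@measurable_fun_cvg _ _ _ _ (fun n (p : R * T) => Y (phi n p.1) p.2)).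
- move=> n _ B mB; rewrite setTI.
  pose J (k : int) := `[k%:~R / c n, (k + 1)%:~R / c n[%classic : set R.
  have -> : (fun p : R * T => Y (phi n p.1) p.2) @^-1` B =
      \bigcup_k (J k `*` (Y ((k + 1)%:~R / c n) @^-1` B)).
    apply/seteqP; split => [[s w] /= Bw|[s w] [k _ [/=]]].
      exists (Num.floor (s * c n)) => //; split => //=.
      by rewrite /J /= in_itv/= ler_pdivrMr// ltr_pdivlMr// floor_itv.
    rewrite /J /= in_itv/= ler_pdivrMr// ltr_pdivlMr// => /floor_def + Bk.
    by rewrite /phi => ->.
  apply: countable_bigcupT_measurable => // k; apply: measurableX.
    exact: measurable_itv.
  by rewrite -[X in measurable X]setTI; exact: mY.
- move=> [s w] _ /=.
  have /cvg_at_rightP := rY w s; apply; split => //.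
  apply: (@squeeze_cvgr _ _ _ _ (fun=> s) (fun n => s + harmonic n)).
  + by apply: nearW => n; rewrite (ltW (phi_gt _ _)) phi_le.
  + exact: cvg_cst.
  + by rewrite -[X in _ --> X]addr0; apply: cvgD; [exact: cvg_cst|exact: cvg_harmonic].
Qed.

(** The left limit is the pointwise limit of [Y] at the times [s - 1 / (n + 1)], jointly measurable
    by the right continuous case. *)
Lemma left_limit_measurable Y :
  (forall s, measurable_fun setT (Y s)) ->
  (forall w, cadlag (Y ^~ w)) ->
  measurable_fun setT (fun p : R * T => llim (Y ^~ p.2) p.1).
Proof.
move=> mY cY.
apply: (@measurable_fun_cvg _ _ _ _ (fun n (p : R * T) => Y (p.1 - harmonic n) p.2)).
- move=> n.
  have mYp := right_continuous_measurable mY (fun w s => (cY w s).1).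
  apply: (measurableT_comp (f := fun p : R * T => Y p.1 p.2)
     (g := fun p : R * T => (p.1 - harmonic n, p.2)) mYp).
  apply: measurable_fun_pair => //.
  by apply: measurable_funB => //; exact: measurable_fst.
- move=> [s w] _ /=; have [_ /cvg_at_leftP] := cY w s; apply; split.
    by move=> n; rewrite ltrBlDr ltrDl harmonic_gt0.
  rewrite -[X in _ --> X]subr0; apply: cvgB; first exact: cvg_cst.
  exact: cvg_harmonic.
Qed.

(** Tonelli's theorem applies to the positive and negative parts of [g] cut off outside [D]; taking
    their difference and then [fine] preserves measurability, whether or not the integrals are
    finite. *)
Lemma measurable_Rintegral_parameter (g : R * T -> R) (D : set R) :
  measurable D -> measurable_fun setT g ->
  measurable_fun setT
    (fun w => \int[@lebesgue_measure R]_(s in D) g (s, w)).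
Proof.
move=> mD mg; rewrite /Rintegral.
apply: measurableT_comp; first exact: fine_measurable.
pose h (p : R * T) : \bar R := ((EFin \o g) \_ (D `*` setT)) p.
have mh : measurable_fun setT h.
  apply/(measurable_restrictT _ _).1; first exact: measurableX.
  by apply: measurable_funTS; exact/measurable_EFinP.
have -> : (fun w => \int[@lebesgue_measure R]_(s in D) (g (s, w))%:E)%E =
   (fun w => fubini_G (@lebesgue_measure R) (h^\+)%E w -
             fubini_G (@lebesgue_measure R) (h^\-)%E w)%E.
  apply/funext => w; rewrite integral_mkcond integralE; congr (_ - _)%E.
    rewrite /fubini_G; apply: eq_integral => s _; rewrite !funeposE /h !patchE.
    by congr Order.max; rewrite in_setX in_setT andbT.
  rewrite /fubini_G; apply: eq_integral => s _; rewrite !funenegE /h !patchE.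
  by congr (Order.max (- _) _)%E; rewrite in_setX in_setT andbT.
apply: emeasurable_funB; apply: measurable_fun_fubini_tonelli_G => //.
- exact: measurable_funepos.
- exact: measurable_funeneg.
Qed.

End JointMeasurability.

(** * Lebesgue integrals over bounded time intervals *)

Section LebesgueOnIntervals.
Context {R : realType}.
Implicit Types (g h k x : R -> R) (s t u : R).
Local Notation leb := (@lebesgue_measure R).

(** This is joint measurability over a one-point outcome space. *)
Lemma cadlag_measurable x : cadlag x -> measurable_fun setT x.
Proof.
move=> cx; pose Y (s : R) (_ : unit) := x s.
have := @right_continuous_measurable R _ unit Y (fun=> measurable_cst _)
  (fun _ s => (cx s).1).
exact: (@measurable_fun_pair1 _ _ _ _ _ _ _ tt).
Qed.

Lemma llim_measurable x : cadlag x -> measurable_fun setT (llim x).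
Proof.
move=> cx; pose Y (s : R) (_ : unit) := x s.
have := @left_limit_measurable R _ unit Y (fun=> measurable_cst _)
  (fun _ => cx).
exact: (@measurable_fun_pair1 _ _ _ _ _ _ _ tt).
Qed.

Lemma bounded_integrable g (i : interval R) (a b D : R) :
  measurable_fun setT g -> [set` i] `<=` `[a, b]%classic ->
  (forall s, s \in i -> `|g s| <= D) ->
  leb.-integrable [set` i] (EFin \o g).
Proof.
move=> mg iab gD; apply: measurable_bounded_integrable => //.
- apply: (@le_lt_trans _ _ (leb `[a, b]%classic)).
    by apply: le_measure; rewrite ?inE//; exact: measurable_itv.
  by rewrite lebesgue_measure_itv/=; case: ifPn => _; rewrite -?EFinD ltry.
- exact: measurable_funTS.
- exists D; split; [exact: num_real|move=> D' DD' s /= si]; apply: le_trans (gD _ si) _.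
  exact: ltW.
Qed.

Lemma bounded_cvg_Rintegral (h_ : nat -> R -> R) h (b D : R) :
  (forall n, measurable_fun setT (h_ n)) ->
  (forall n s, 0 <= s -> s <= b -> `|h_ n s| <= D) ->
  (forall s, h_ n s @[n --> \oo] --> h s) ->
  \int[leb]_(s in `[0, b]) h_ n s @[n --> \oo] -->
  \int[leb]_(s in `[0, b]) h s.
Proof.
move=> mh hD hh.
have mlim : measurable_fun setT h by exact: measurable_fun_cvg mh (fun s _ => hh s).
have mh_E n : measurable_fun `[0, b] (EFin \o h_ n).
  by apply/measurable_EFinP; exact: measurable_funTS.
have mhE : measurable_fun `[0, b] (EFin \o h).
  by apply/measurable_EFinP; exact: measurable_funTS.
have hhE : {ae leb, forall s, `[0, b]%classic s ->
    (EFin \o h_ n) s @[n --> \oo] --> (EFin \o h) s}.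
  by apply: aeW => s _; apply: cvg_EFin; [exact: nearW|exact: hh].
have iD : leb.-integrable `[0, b] (EFin \o (fun=> D)).
  exact: (@bounded_integrable (fun=> D) `[0, b] 0 b `|D|).
have hDE : {ae leb, forall s n, `[0, b]%classic s ->
    (`|(EFin \o h_ n) s| <= (EFin \o (fun=> D)) s)%E}.
  apply: aeW => s n /=; rewrite in_itv/= lee_fin => /andP[s0 sb].
  exact: hD.
have [ih _ cv] := @dominated_convergence _ _ _ leb _ (measurable_itv `[0, b])
  _ _ _ mh_E mhE hhE iD hDE.
rewrite /Rintegral; apply: fine_cvg; rewrite fineK//.
exact: integrable_fin_num ih.
Qed.

(** The domain of integration does not depend on [t], so one-sided limits of the kernel pass through
    the integral by dominated convergence, with the constant bound [M * D]. *)
Lemma convolution_cadlag k g (b M D : R) : cadlag k ->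
  (forall s, `|k s| <= M) -> measurable_fun setT g ->
  (forall s, 0 <= s -> s <= b -> `|g s| <= D) ->
  cadlag (fun t => \int[leb]_(s in `[0, b]) (k (t - s) * g s)).
Proof.
move=> ck kM mg gD t.
have mk t' : measurable_fun setT (fun s => k (t' - s)).
  apply: measurableT_comp; first exact: cadlag_measurable.
  exact: measurable_funB.
have bnd t' s : 0 <= s -> s <= b -> `|k (t' - s) * g s| <= M * D.
  by move=> s0 sb; rewrite normrM ler_pM// gD.
split.
  apply/cvg_at_rightP => u [ut tu].
  apply: (@bounded_cvg_Rintegral _ _ _ (M * D)) => //.
  - by move=> n; apply: measurable_funM.
  - by move=> n; exact: bnd.
  - move=> s; apply: cvgM; last exact: cvg_cst.
    have [/cvg_at_rightP + _] := ck (t - s).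
    apply; split; first by move=> n; rewrite ltrD2r.
    by apply: cvgB => //; exact: cvg_cst.
apply/cvg_ex; exists (\int[leb]_(s in `[0, b]) (llim k (t - s) * g s)).
apply/cvg_at_leftP => u [ut tu].
apply: (@bounded_cvg_Rintegral _ _ _ (M * D)) => //.
- by move=> n; apply: measurable_funM.
- by move=> n; exact: bnd.
- move=> s; apply: cvgM; last exact: cvg_cst.
  have [_ /cvg_at_leftP] := ck (t - s).
  apply; split; first by move=> n; rewrite ltrD2r.
  by apply: cvgB => //; exact: cvg_cst.
Qed.

Lemma Rintegral_expR (L t : R) : 0 < L -> 0 < t ->
  \int[leb]_(s in `[0, t]) expR (L * s) = (expR (L * t) - 1) / L.
Proof.
move=> L0 t0; rewrite /Rintegral.
rewrite (@continuous_FTC2 _ (fun s => expR (L * s)) (fun s => expR (L * s) / L))//.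
- by rewrite /= mulr0 expR0 mulrBl.
- apply: continuous_subspaceT => s.
  apply: continuous_comp; first exact: mulrl_continuous.
  exact: continuous_expR.
- split.
  + move=> s _; exact: ex_derive.
  + apply: cvg_at_right_filter; apply: cvgM; last exact: cvg_cst.
    apply: continuous_comp; first exact: mulrl_continuous.
    exact: continuous_expR.
  + apply: cvg_at_left_filter; apply: cvgM; last exact: cvg_cst.
    apply: continuous_comp; first exact: mulrl_continuous.
    exact: continuous_expR.
- move=> s _; rewrite derive1E derive_val.
  rewrite /GRing.scale/=; field. exact: lt0r_neq0.
Qed.

(** Integrating the weight gains a factor [1 / L], the source of every contraction below. The open
    interval leaves out time 0, where a left limit involves negative times. *)
Lemma Rintegral_norm_le_expR g t (L Q : R) : 0 < L -> 0 <= Q ->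
  leb.-integrable `]0, t[ (EFin \o g) ->
  (forall s, 0 < s -> s < t -> `|g s| <= Q * expR (L * s)) ->
  `|\int[leb]_(s in `]0, t[) g s| <= Q * expR (L * t) / L.
Proof.
move=> L0 Q0 ig gQ; have [t0|t0] := leP t 0.
  rewrite set_itv_ge ?bnd_simp -?leNgt// Rintegral_set0 normr0.
  by rewrite divr_ge0 ?mulr_ge0 ?expR_ge0// ltW.
have mexp : measurable_fun setT (fun s : R => Q * expR (L * s)).
  apply: measurable_funM => //; exact: measurableT_comp.
have iexp (i : interval R) : [set` i] `<=` `[0, t]%classic ->
    leb.-integrable [set` i] (EFin \o (fun s => Q * expR (L * s))).
  move=> it; apply: (@bounded_integrable _ _ 0 t (Q * expR (L * t))) => //.
  move=> s /it/=; rewrite in_itv/= => /andP[_ st].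
  rewrite ger0_norm ?mulr_ge0 ?expR_ge0// ler_wpM2l// ler_expR ler_wpM2l//.
  exact: ltW.
apply: (le_trans (le_normr_Rintegral _ _)) => //.
apply: (@le_trans _ _ (\int[leb]_(s in `]0, t[) (Q * expR (L * s)))).
  apply: le_Rintegral => //.
  - exact: (integrable_norm ig).
  - by apply: iexp; apply: subset_itv; rewrite bnd_simp.
  - by move=> s /=; rewrite in_itv/= => /andP[]; exact: gQ.
rewrite Rintegral_itv_bndo_bndc; last by apply: iexp; apply: subset_itv; rewrite bnd_simp.
rewrite Rintegral_itv_obnd_cbnd; last by apply: iexp; apply: subset_itv; rewrite bnd_simp.
rewrite RintegralZl//; last first.
  apply: (@bounded_integrable _ _ 0 t (expR (L * t))) => //.
    exact: measurableT_comp.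
  move=> s; rewrite in_itv/= => /andP[_ st].
  by rewrite ger0_norm ?expR_ge0// ler_expR ler_wpM2l// ltW.
rewrite Rintegral_expR// -mulrA ler_wpM2l// ler_pM2r ?invr_gt0//.
by rewrite gerBl.
Qed.

End LebesgueOnIntervals.

(** * The two integrals of the equation: bounds and path regularity *)

Section Drift.
Context {R : realType} (mu : {measure set (measurableTypeR R) -> \bar R}).
Context (mu_fin : (mu `[0%R, +oo[%classic < +oo)%E).
Implicit Types (g x y : R -> R) (s t u b : R).
Local Notation leb := (@lebesgue_measure R).
Local Notation m := (m_minus mu).

Let integrable_subitv (i j : interval R) g : [set` j] `<=` [set` i] ->
  leb.-integrable [set` i] (EFin \o g) -> leb.-integrable [set` j] (EFin \o g).
Proof. by move=> ji; apply: integrableS. Qed.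

Definition total_mass : R := fine (mu `[0%R, +oo[%classic).

Let mu_le_total (A : set R) : measurable A -> A `<=` `[0%R, +oo[%classic ->
  fine (mu A) <= total_mass /\ (mu A \is a fin_num).
Proof.
move=> mA A0.
have leA : (mu A <= mu `[0%R, +oo[%classic)%E.
  by apply: le_measure; rewrite ?inE//; exact: measurable_itv.
have fA : mu A \is a fin_num.
  by rewrite ge0_fin_numE// (le_lt_trans leA).
by split => //; apply: fine_le => //; rewrite ge0_fin_numE.
Qed.

Let sub_oc (t : R) : `]0, t]%classic `<=` (`[0%R, +oo[%classic : set R).
Proof. by move=> s /=; rewrite !in_itv/= andbT => /andP[/ltW]. Qed.

Lemma m_minus_ge0 t : 0 <= m t.
Proof. exact: fine_ge0. Qed.

Lemma m_minus_le t : m t <= total_mass.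
Proof. by have [] := mu_le_total (measurable_itv _) (@sub_oc t). Qed.

Lemma m_minus_eq0 t : t <= 0 -> m t = 0.
Proof. by move=> t0; rewrite /m_minus set_itv_ge ?measure0// bnd_simp -leNgt. Qed.

Lemma m_minus_nd : {homo m : s t / s <= t}.
Proof.
move=> s t st; rewrite /m_minus fine_le//.
- by have [] := mu_le_total (measurable_itv _) (@sub_oc s).
- by have [] := mu_le_total (measurable_itv _) (@sub_oc t).
- apply: le_measure; rewrite ?inE//; try exact: measurable_itv.
  by apply: subset_itv; rewrite bnd_simp.
Qed.

(** A bounded monotone function has one-sided limits. The right limit at [t] is [m t] by continuity
    of the finite measure from above, along the intervals []0, t + 1 / (n + 1)]] that shrink to []0,
    t]]. *)
Lemma m_minus_cadlag : cadlag m.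
Proof.
move=> t; split; last first.
  apply: nondecreasing_at_left_is_cvgr.
    by near=> u => a b _ _; exact: m_minus_nd.
  near=> u; exists total_mass => _ [s _ <-]; exact: m_minus_le.
have /cvg_ex[l ml] : cvg (m u @[u --> t^'+]).
  apply: nondecreasing_at_right_is_cvgr.
    by near=> u => a b _ _; exact: m_minus_nd.
  near=> u; exists 0 => _ [s _ <-]; exact: m_minus_ge0.
suff -> : m t = l by [].
pose A n : set (measurableTypeR R) := `]0, t + harmonic n]%classic.
have mAl : fine (mu (A n)) @[n --> \oo] --> l.
  have /cvg_at_rightP/(_ (fun n => t + harmonic n)) := ml.
  apply; split; first by move=> n; rewrite ltrDl harmonic_gt0.
  rewrite -[X in _ --> X]addr0; apply: cvgD; first exact: cvg_cst.
  exact: cvg_harmonic.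
have capA : \bigcap_n A n = `]0, t]%classic.
  apply/seteqP; split => s /=; last first.
    rewrite in_itv/= => /andP[s0 st] n _; rewrite /A/= in_itv/= s0/=.
    by rewrite (le_trans st)// lerDl harmonic_ge0.
  move=> As; have := As 0%N I; rewrite /A/= !in_itv/= => /andP[-> _]/=.
  have ct : t + harmonic n @[n --> \oo] --> t.
    rewrite -[X in _ --> X]addr0; apply: cvgD; first exact: cvg_cst.
    exact: cvg_harmonic.
  rewrite -(cvg_lim _ ct)//; apply: limr_ge; first by apply/cvg_ex; exists t.
  by apply: nearW => n; have := As n I; rewrite /A/= in_itv/= => /andP[].
have mAm : fine (mu (A n)) @[n --> \oo] --> m t.
  rewrite /m_minus -capA; apply: fine_cvg; rewrite fineK; last first.
    by rewrite capA; have [] := mu_le_total (measurable_itv _) (@sub_oc t).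
  apply: nonincreasing_cvg_mu.
  - have [_ ] := mu_le_total (measurable_itv _) (@sub_oc (t + harmonic 0)).
    by rewrite ge0_fin_numE.
  - by move=> n; exact: measurable_itv.
  - by rewrite capA; exact: measurable_itv.
  - move=> n k nk; apply/subsetPset; apply: subset_itv; rewrite bnd_simp//.
    by rewrite lerD2l /harmonic lef_pV2 ?posrE ?ltr0n// ler_nat.
by rewrite -(cvg_lim _ mAm)// (cvg_lim _ mAl).
Unshelve. all: by end_near. Qed.

Lemma point_mass_le : 0 <= fine (mu [set 0]) <= total_mass.
Proof.
rewrite fine_ge0//=; have [] := @mu_le_total [set 0 : R] => //.
by move=> _ ->/=; rewrite in_itv/= lexx.
Qed.

(* The two integrals of the equation, with s |-> f (X (s-)) and s |-> f (X s)
   replaced by g1 and g2. *)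
Definition conv (g1 g2 : R -> R) (t : R) : R :=
  fine (mu [set 0]) * (\int[leb]_(s in `[0, t]) g1 s) +
  \int[leb]_(s in `[0, t[) (m (t - s) * g2 s).

Definition conv_integrable (g1 g2 : R -> R) (t : R) : Prop :=
  leb.-integrable `[0, t] (EFin \o g1) /\
  leb.-integrable `[0, t[ (EFin \o (fun s => m (t - s) * g2 s)).

(** A difference of two drifts becomes a single [conv], so that [conv_norm_le] yields both the
    growth and the Lipschitz estimates. *)
Lemma convB g1 g2 h1 h2 t : conv_integrable g1 g2 t -> conv_integrable h1 h2 t ->
  conv_integrable (g1 \- h1) (g2 \- h2) t /\
  conv (g1 \- h1) (g2 \- h2) t = conv g1 g2 t - conv h1 h2 t.
Proof.
move=> [ig1 ig2] [ih1 ih2].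
have E : (fun s => m (t - s) * (g2 \- h2) s) =
    (fun s => m (t - s) * g2 s) \- (fun s => m (t - s) * h2 s).
  by apply/funext => s; rewrite /= mulrBr.
have intB (D : set R) (p q : R -> R) : measurable D ->
    leb.-integrable D (EFin \o p) -> leb.-integrable D (EFin \o q) ->
    leb.-integrable D (EFin \o (p \- q)).
  move=> mD ip iq; apply: eq_integrable (@integrableB _ _ _ leb D mD _ _ ip iq) => // s _.
rewrite /conv_integrable /conv E; split; first by split; exact: intB.
by rewrite !RintegralB//; ring.
Qed.

(** The mass at 0 and the kernel [m] are both at most the total mass; each of the two integrals
    gains [1 / L], whence the factor 2. *)
Lemma conv_norm_le g1 g2 t (L Q : R) : 0 < L -> 0 <= Q ->
  conv_integrable g1 g2 t ->
  (forall s, 0 < s -> s < t -> `|g1 s| <= Q * expR (L * s)) ->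
  (forall s, 0 < s -> s < t -> `|g2 s| <= Q * expR (L * s)) ->
  `|conv g1 g2 t| <= total_mass *+ 2 * Q / L * expR (L * t).
Proof.
move=> L0 Q0 [ig1 ig2] g1Q g2Q; have /andP[a0 aM] := point_mass_le.
have M0 : 0 <= total_mass := le_trans a0 aM.
have sub1 : `]0, t[%classic `<=` `[0, t]%classic.
  by apply: subset_itv; rewrite bnd_simp.
have sub2 : `]0, t[%classic `<=` `[0, t[%classic.
  by apply: subset_itv; rewrite bnd_simp.
(* Single points are Lebesgue null, so both domains shrink to []0, t[]. *)
rewrite /conv -Rintegral_itv_obnd_cbnd; last first.
  by apply: integrable_subitv ig1; apply: subset_itv; rewrite bnd_simp.
rewrite -Rintegral_itv_bndo_bndc; last exact: integrable_subitv ig1.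
rewrite -Rintegral_itv_obnd_cbnd; last exact: integrable_subitv ig2.
have I1 := Rintegral_norm_le_expR L0 Q0 (integrable_subitv sub1 ig1) g1Q.
have I2 := Rintegral_norm_le_expR L0 (mulr_ge0 M0 Q0) (integrable_subitv sub2 ig2).
apply: (le_trans (ler_normD _ _)); rewrite normrM ger0_norm//.
have -> : total_mass *+ 2 * Q / L * expR (L * t) =
    total_mass * (Q * expR (L * t) / L) + total_mass * Q * expR (L * t) / L.
  by rewrite mulr2n; ring.
apply: lerD; first by apply: ler_pM => //; exact: I1.
apply: I2 => // s s0 st; rewrite normrM -mulrA; apply: ler_pM => //.
- by rewrite ger0_norm ?m_minus_ge0// m_minus_le.
- exact: g2Q.
Qed.

Lemma conv_cadlag g1 g2 :
  measurable_fun setT g1 -> measurable_fun setT g2 ->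
  (forall b, exists D, forall s, 0 <= s -> s <= b -> `|g1 s| <= D /\ `|g2 s| <= D) ->
  cadlag (conv g1 g2).
Proof.
move=> mg1 mg2 gD.
(* As k and m vanish at negative times, both integrals can be taken over a fixed
   interval [0, n], where only the kernels depend on t. *)
pose k (r : R) : R := (0 <= r)%R%:R.
have kc : cadlag k.
  move=> t; split.
    apply: cvg_near_cst; have [t0|t0] := ltP t 0.
      near=> u; have u0 : u < 0 by near: u; exact: nbhs_right_lt.
      by rewrite /k (lt_geF t0) (lt_geF u0).
    near=> u; have tu : t <= u by near: u; exact: nbhs_right_ge.
    by rewrite /k t0 (le_trans t0).
  apply/cvg_ex; have [t0|t0] := leP t 0.
    exists 0; apply: cvg_near_cst; near=> u.
    have ut : u < t by near: u; exact: nbhs_left_lt.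
    by rewrite /k (lt_geF (lt_le_trans ut t0)).
  exists 1; apply: cvg_near_cst; near=> u.
  have u0 : 0 <= u by near: u; exact: nbhs_left_ge.
  by rewrite /k u0.
have kM s : `|k s| <= 1 by rewrite /k; case: (0 <= s); rewrite ?normr0 ?normr1.
have mM s : `|m s| <= total_mass by rewrite ger0_norm ?m_minus_ge0// m_minus_le.
pose y (n : nat) (t : R) : R :=
  fine (mu [set 0]) * (\int[leb]_(s in `[0, n%:R]) (k (t - s) * g1 s)) +
  \int[leb]_(s in `[0, n%:R]) (m (t - s) * g2 s).
have yc n : cadlag (y n).
  have [D gDn] := gD n%:R.
  have c1 := @convolution_cadlag _ k g1 n%:R 1 D kc kM mg1
    (fun s p q => (gDn s p q).1).
  have c2 := @convolution_cadlag _ m g2 n%:R total_mass D m_minus_cadlag mM mg2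
    (fun s p q => (gDn s p q).2).
  move=> t; have [r1 l1] := c1 t; have [r2 l2] := c2 t; split.
    by apply: cvgD => //; apply: cvgM => //; exact: cvg_cst.
  by apply: is_cvgD => //; apply: is_cvgM => //; exact: is_cvg_cst.
(* As soon as [b <= n], [y n] equals the convolution at all times up to [b], so the distance is
   0. *)
apply: (uniform_limit_cadlag yc) => b e e0.
have [n bn] : exists n : nat, b <= n%:R.
  exists (Num.bound `|b|); apply: le_trans (ler_norm b) _.
  exact: ltW (archi_boundP (normr_ge0 b)).
exists n => t tb; have tn := le_trans tb bn.
suff -> : y n t = conv g1 g2 t by rewrite subrr normr0 ltW.
rewrite /y /conv; congr (_ * _ + _); rewrite Rintegral_mkcond [RHS]Rintegral_mkcond.
  congr Rintegral; apply/funext => s; rewrite !patchE !mem_setE !in_itv/= /k subr_ge0.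
  have [s0|s0] /= := leP 0 s => //.
  have [st|st] /= := leP s t; first by rewrite (le_trans st)// mul1r.
  by rewrite mul0r if_same.
congr Rintegral; apply/funext => s; rewrite !patchE !mem_setE !in_itv/=.
have [s0|s0] /= := leP 0 s => //.
have [st|st] /= := ltP s t; first by rewrite (le_trans (ltW st)).
by rewrite m_minus_eq0 ?subr_le0// mul0r if_same.
Unshelve. all: by end_near. Qed.

End Drift.

(** * Sequences controlled by powers of one half *)

Section GeometricSequences.
Context {R : realType}.

Lemma cvg_half_expn (A : R) : A / 2 ^+ n @[n --> \oo] --> 0.
Proof.
have -> : (fun n => A / 2 ^+ n) = geometric A 2^-1.
  by apply/funext => n; rewrite /geometric/= exprVn.
by apply: cvg_geometric; rewrite ger0_norm ?invr_ge0// invf_lt1// ltr1n.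
Qed.

Lemma half_expn_eq0 (a A : R) : (forall n, `|a| <= A / 2 ^+ n) -> a = 0.
Proof.
move=> aA; apply/eqP; rewrite -normr_le0 -(cvg_lim _ (cvg_half_expn A))//.
apply: limr_ge; last exact: nearW.
by apply/cvg_ex; exists 0; exact: cvg_half_expn.
Qed.

Lemma half_expn_cauchy (v : nat -> R) (A : R) :
  (forall n k, `|v (n + k)%N - v n| <= A / 2 ^+ n) ->
  cvg (v n @[n --> \oo]) /\
  forall n, `|lim (v k @[k --> \oo]) - v n| <= A / 2 ^+ n.
Proof.
move=> vA; have cv : cvg (v n @[n --> \oo]).
  apply: cauchy_cvg; apply: cauchy_exP => e e0.
  have /cvgrPdist_lt/(_ _ e0)[n _ /(_ n (leqnn n))/=] := cvg_half_expn A.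
  rewrite sub0r normrN => nA; exists (v n), n => // k /= nk.
  rewrite -ball_normE /= distrC -(subnKC nk).
  exact: le_lt_trans (vA _ _) (le_lt_trans (ler_norm _) nA).
split => // n.
have cn : `|v k - v n| @[k --> \oo] --> `|lim (v k @[k --> \oo]) - v n|.
  by apply: cvg_norm; apply: cvgB => //; exact: cvg_cst.
rewrite -(cvg_lim _ cn)//; apply: limr_le; first by apply/cvg_ex; eexists; exact: cn.
by exists n => // k /= nk; rewrite -(subnKC nk).
Qed.

End GeometricSequences.

(** * Uniqueness and Picard iteration for a single path *)

Section PathwiseEquation.
Context {R : realType} (mu : {measure set (measurableTypeR R) -> \bar R}).
Context (mu_fin : (mu `[0%R, +oo[%classic < +oo)%E).
Context (f : R -> R) (mf : measurable_fun setT f).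
Context (f_lip : forall r : R, 0 < r -> exists K : R, 0 < K /\
  forall x y : R, x \in `[- r, r] -> y \in `[- r, r] ->
  `|f x - f y| <= K * `|x - y|).
Context (f_growth : exists K eta : R, [/\ 0 < K, 0 < eta &
  forall x : R, `|f x| <= K + eta * `|x|]).
Implicit Types (x y : R -> R) (s t u b : R).

(** This is the factor of [conv_norm_le], increased by 1 so that it is positive for every finite
    measure and the rates [L] built from it are positive too. *)
Let C : R := total_mass mu *+ 2 + 1.

Let M_ge0 : 0 <= total_mass mu.
Proof. exact: fine_ge0. Qed.

Let C_gt0 : 0 < C.
Proof. by rewrite ltr_wpDl ?mulrn_wge0. Qed.

Definition drift x : R -> R := conv mu (f \o llim x) (f \o x).

Definition drift_integrable x t : Prop :=
  conv_integrable mu (f \o llim x) (f \o x) t.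

Lemma drift_lt0 x t : t < 0 -> drift x t = 0.
Proof.
move=> t0; rewrite /drift /conv !set_itv_ge ?bnd_simp -?ltNge -?leNgt ?(ltW t0)//.
by rewrite !Rintegral_set0 mulr0 addr0.
Qed.

Let f_local_bound x b : cadlag x -> exists D, forall s, 0 <= s -> s <= b ->
  `|(f \o llim x) s| <= D /\ `|(f \o x) s| <= D.
Proof.
move=> cx; have [K [eta [K0 eta0 fK]]] := f_growth.
(* The bound starts at -1 because the left limit at time 0 depends on negative times. *)
have [D D0 xD] := @cadlag_bounded _ x (-1) b cx.
exists (K + eta * D) => s s0 sb; split; apply: (le_trans (fK _)).
  rewrite lerD2l ler_pM2l//; apply: llim_norm_le; first exact: (cx s).2.
  near=> u; apply: xD.
    by near: u; apply: nbhs_left_ge; lra.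
  by apply: (le_trans _ sb); near: u; exact: nbhs_left_le.
by rewrite lerD2l ler_pM2l//; apply: xD => //; apply: le_trans s0; lra.
Unshelve. all: by end_near. Qed.

Let mf_llim x : cadlag x -> measurable_fun setT (f \o llim x).
Proof. by move=> cx; apply: measurableT_comp => //; exact: llim_measurable. Qed.

Let mf_path x : cadlag x -> measurable_fun setT (f \o x).
Proof. by move=> cx; apply: measurableT_comp => //; exact: cadlag_measurable. Qed.

Lemma drift_cadlag x : cadlag x -> cadlag (drift x).
Proof.
move=> cx; apply: conv_cadlag => //; [exact: mf_llim|exact: mf_path|].
by move=> b; exact: f_local_bound.
Qed.

Lemma cadlag_drift_integrable x t : cadlag x -> drift_integrable x t.
Proof.
move=> cx; have [D fD] := f_local_bound t cx; split.
  apply: (@bounded_integrable _ _ _ 0 t D) => //; first exact: mf_llim.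
  by move=> s; rewrite in_itv/= => /andP[s0 st]; have [] := fD s s0 st.
apply: (@bounded_integrable _ _ _ 0 t (total_mass mu * D)).
- apply: measurable_funM; last exact: mf_path.
  apply: measurableT_comp; first exact: cadlag_measurable (m_minus_cadlag mu_fin).
  exact: measurable_funB.
- by apply: subset_itv; rewrite bnd_simp.
- move=> s; rewrite in_itv/= => /andP[s0 /ltW st]; have [_ fsD] := fD s s0 st.
  rewrite normrM ler_pM// ger0_norm ?m_minus_ge0//.
  exact: m_minus_le.
Qed.

Let llim_le_expR x t (L Q : R) : 0 < L -> 0 <= Q -> cvg (x u @[u --> t^'-]) ->
  0 < t -> (forall u, 0 < u -> u < t -> `|x u| <= Q * expR (L * u)) ->
  `|llim x t| <= Q * expR (L * t).
Proof.
move=> L0 Q0 cx t0 xQ; apply: llim_norm_le => //; near=> u.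
have ut : u < t by near: u; exact: nbhs_left_lt.
have u0 : 0 < u by near: u; exact: nbhs_left_gt.
apply: (le_trans (xQ u u0 ut)); rewrite ler_wpM2l// ler_expR ler_pM2l// ltW.
Unshelve. all: by end_near. Qed.

(** The additive constant [K] of the growth bound is absorbed by the weight, which is at least 1 at
    positive times; thus [f] along the path is at most [K + eta * Q] times the weight. *)
Lemma drift_norm_le x t (L Q K eta : R) : 0 < L -> 0 <= Q -> 0 <= K -> 0 <= eta ->
  (forall r, `|f r| <= K + eta * `|r|) -> cadlag x ->
  (forall s, 0 < s -> s < t -> `|x s| <= Q * expR (L * s)) ->
  `|drift x t| <= C * (K + eta * Q) / L * expR (L * t).
Proof.
move=> L0 Q0 K0 eta0 fK cx xQ.
have E r s : 0 < s -> `|r| <= Q * expR (L * s) ->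
    `|f r| <= (K + eta * Q) * expR (L * s).
  move=> s0 rQ; apply: (le_trans (fK r)); rewrite mulrDl; apply: lerD.
    by rewrite ler_peMr// -expR0 ler_expR mulr_ge0// ltW.
  by rewrite -mulrA ler_wpM2l.
have KQ : 0 <= K + eta * Q by rewrite addr_ge0// mulr_ge0.
apply: (le_trans (conv_norm_le mu_fin L0 KQ (cadlag_drift_integrable t cx) _ _)).
- move=> s s0 st; apply: E => //; apply: llim_le_expR => //.
    exact: (cx s).2.
  by move=> u u0 us; apply: xQ => //; exact: lt_trans st.
- by move=> s s0 st; apply: E => //; exact: xQ.
- rewrite ler_wpM2r ?expR_ge0// ler_wpM2r ?invr_ge0 ?(ltW L0)// ler_wpM2r//.
  by rewrite /C lerDl.
Qed.

(** The Lipschitz bound on [[-D, D]] applies because both paths, hence also their left limits, stay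
    there. The hypotheses concern only times up to [t], so that strong solutions with a finite
    lifetime qualify. *)
Lemma drift_dist_le x y t (L Q D K : R) : 0 < L -> 0 <= Q -> 0 <= K ->
  (forall r r' : R, r \in `[- D, D] -> r' \in `[- D, D] ->
    `|f r - f r'| <= K * `|r - r'|) ->
  drift_integrable x t -> drift_integrable y t ->
  (forall s, 0 < s -> s < t ->
    cvg (x u @[u --> s^'-]) /\ cvg (y u @[u --> s^'-])) ->
  (forall s, 0 < s -> s < t -> `|x s| <= D /\ `|y s| <= D) ->
  (forall s, 0 < s -> s < t -> `|x s - y s| <= Q * expR (L * s)) ->
  `|drift x t - drift y t| <= C * (K * Q) / L * expR (L * t).
Proof.
move=> L0 Q0 K0 fK ix iy cxy xyD xyQ.
have E r r' s : `|r| <= D -> `|r'| <= D -> `|r - r'| <= Q * expR (L * s) ->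
    `|f r - f r'| <= K * Q * expR (L * s).
  move=> rD rD' rr; apply: (@le_trans _ _ (K * `|r - r'|)).
    by apply: fK; rewrite in_itv/= -ler_norml.
  by rewrite -mulrA ler_wpM2l.
have [ixy exy] := convB ix iy.
have KQ : 0 <= K * Q by rewrite mulr_ge0.
rewrite /drift -exy.
apply: (le_trans (conv_norm_le mu_fin L0 KQ ixy _ _)).
- move=> s s0 st /=; have [cx cy] := cxy s s0 st.
  have Hu : \forall u \near s^'-, 0 < u /\ u < t.
    near=> u; split; first by near: u; exact: nbhs_left_gt.
    by apply: lt_trans st; near: u; exact: nbhs_left_lt.
  apply: E.
  + by apply: llim_norm_le => //; apply: filterS Hu => u [u0 ut]; have [] := xyD u u0 ut.
  + by apply: llim_norm_le => //; apply: filterS Hu => u [u0 ut]; have [] := xyD u u0 ut.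
  + have -> : llim x s - llim y s = llim (x \- y) s.
      by rewrite /llim -limB.
    apply: llim_le_expR => //; first exact: is_cvgB.
    by move=> u u0 us; apply: xyQ => //; exact: lt_trans st.
- by move=> s s0 st /=; have [? ?] := xyD s s0 st; apply: E => //; exact: xyQ.
- rewrite ler_wpM2r ?expR_ge0// ler_wpM2r ?invr_ge0 ?(ltW L0)// ler_wpM2r//.
  by rewrite /C lerDl.
Unshelve. all: by end_near. Qed.

(* In the norm sup_t |x t| expR (- L * t) the drift contracts by 1/2 on paths
   bounded by D when L is 2 C times the Lipschitz constant of f on [-D, D]. *)
Lemma drift_contraction (D : R) : 0 < D -> exists2 L, 0 < L &
  forall x y t (Q : R), 0 <= Q ->
  drift_integrable x t -> drift_integrable y t ->
  (forall s, 0 < s -> s < t ->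
    cvg (x u @[u --> s^'-]) /\ cvg (y u @[u --> s^'-])) ->
  (forall s, 0 < s -> s < t -> `|x s| <= D /\ `|y s| <= D) ->
  (forall s, 0 < s -> s < t -> `|x s - y s| <= Q * expR (L * s)) ->
  `|drift x t - drift y t| <= Q / 2 * expR (L * t).
Proof.
move=> D0; have [K [K0 fK]] := f_lip D0.
have L0 : 0 < C * K *+ 2 by rewrite mulrn_wgt0// mulr_gt0.
exists (C * K *+ 2) => // x y t Q Q0 ix iy cxy xyD xyQ.
apply: (le_trans (drift_dist_le L0 Q0 (ltW K0) fK ix iy cxy xyD xyQ)).
rewrite ler_wpM2r ?expR_ge0// le_eqVlt; apply/orP; left; apply/eqP.
by field; rewrite !gt_eqF.
Qed.

(** The weighted distance of the two solutions is at most [2 D], and each use of the equation halves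
    this bound, so the distance is zero. *)
Lemma equation_unique x1 x2 z (b D : R) : 0 < D ->
  (forall t, 0 <= t -> t <= b ->
    [/\ drift_integrable x1 t, drift_integrable x2 t,
        x1 t = drift x1 t + z t & x2 t = drift x2 t + z t]) ->
  (forall t, 0 < t -> t <= b ->
    cvg (x1 u @[u --> t^'-]) /\ cvg (x2 u @[u --> t^'-])) ->
  (forall t, 0 <= t -> t <= b -> `|x1 t| <= D /\ `|x2 t| <= D) ->
  forall t, 0 <= t -> t <= b -> x1 t = x2 t.
Proof.
move=> D0 sol cx xD t t0 tb; have [L L0 contr] := drift_contraction D0.
have H n s : 0 <= s -> s <= b ->
    `|x1 s - x2 s| <= (D *+ 2) / 2 ^+ n * expR (L * s).
  elim: n s => [|n IHn] s s0 sb.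
    have [x1D x2D] := xD s s0 sb.
    rewrite expr0 divr1; apply: (@le_trans _ _ (D *+ 2)).
      by rewrite mulr2n (le_trans (ler_normB _ _))// lerD.
    by rewrite ler_peMr ?mulrn_wge0 ?(ltW D0)// -expR0 ler_expR mulr_ge0// ltW.
  have [i1 i2 -> ->] := sol s s0 sb.
  rewrite opprD addrACA subrr addr0 exprSr invfM mulrA.
  apply: contr => //.
  - by rewrite divr_ge0 ?exprn_ge0// mulrn_wge0// ltW.
  - by move=> r r0 rs; apply: cx => //; apply: ltW; exact: lt_le_trans sb.
  - by move=> r r0 rs; apply: xD; [exact: ltW|apply: ltW; exact: lt_le_trans sb].
  - move=> r r0 rs; apply: IHn; first exact: ltW.
    by apply: ltW; exact: lt_le_trans sb.
apply/eqP; rewrite -subr_eq0; apply/eqP.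
apply: (@half_expn_eq0 _ _ (D *+ 2 * expR (L * t))) => n.
by rewrite mulrAC; exact: H.
Qed.

Context (z : R -> R) (cz : cadlag z).

Fixpoint picard (n : nat) : R -> R :=
  if n is n'.+1 then fun t => drift (picard n') t + z t else z.

Lemma picard_cadlag n : cadlag (picard n).
Proof.
elim: n => [//|n IHn] /= t.
have [dr dl] := drift_cadlag IHn t; have [zr zl] := cz t.
by split; [exact: cvgD|exact: is_cvgD].
Qed.

(** The bound is uniform in [n] because it fixes the interval on which the Lipschitz constant, and
    with it the contraction rate, is chosen once for all iterates. *)
Lemma picard_bounded b : exists2 D, 0 < D &
  forall n t, 0 <= t -> t <= b -> `|picard n t| <= D.
Proof.
have [K [eta [K0 eta0 fK]]] := f_growth.
have [c c0 zc] := @cadlag_bounded _ z 0 b cz.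
(* [L] is such that the term of the growth bound linear in [B] contributes [B / 2]; [B] then solves
   [B = C (K + eta B) / L + c], so the bound reproduces itself. *)
pose L := C * eta *+ 2; pose B := (c + C * K / L) *+ 2.
have L0 : 0 < L by rewrite mulrn_wgt0// mulr_gt0.
have CK0 : 0 <= C * K / L by rewrite divr_ge0 ?ltW// mulr_gt0.
have B0 : 0 < B by rewrite mulrn_wgt0// ltr_pwDl.
have cB : c <= B by rewrite /B mulr2n -addrA lerDl addr_ge0// addr_ge0// ltW.
have ge1 t : 0 <= t -> 1 <= expR (L * t).
  by move=> t0; rewrite -expR0 ler_expR mulr_ge0// ltW.
have H n t : 0 <= t -> t <= b -> `|picard n t| <= B * expR (L * t).
  elim: n t => [|n IHn] t t0 tb /=.
    apply: (le_trans (zc t t0 tb)); apply: (le_trans cB).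
    by rewrite ler_peMr ?ge1// ltW.
  apply: (le_trans (ler_normD _ _)).
  have -> : B * expR (L * t) = C * (K + eta * B) / L * expR (L * t) +
      c * expR (L * t).
    rewrite -mulrDl; congr (_ * _); rewrite /B /L; field.
    by rewrite !gt_eqF.
  apply: lerD; last by apply: (le_trans (zc t t0 tb)); rewrite ler_peMr ?ge1// ltW.
  apply: (drift_norm_le L0 (ltW B0) (ltW K0) (ltW eta0)) => //.
    exact: picard_cadlag.
  by move=> s s0 st; apply: IHn; [exact: ltW|apply: ltW; exact: lt_le_trans tb].
exists (B * expR (L * b)); first by rewrite mulr_gt0// expR_gt0.
move=> n t t0 tb; apply: (le_trans (H n t t0 tb)).
by rewrite ler_pM2l// ler_expR ler_pM2l.
Qed.

(** Iterates [n] and [n + k] are compared directly, which avoids summing a series: their weighted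
    distance starts at most at [2 D] and is halved each time both indices advance. *)
Lemma picard_half_expn b : exists A, forall n k t, t <= b ->
  `|picard (n + k) t - picard n t| <= A / 2 ^+ n.
Proof.
have [D D0 pD] := picard_bounded b; have [L L0 contr] := drift_contraction D0.
have D2 : 0 <= D *+ 2 by rewrite mulrn_wge0// ltW.
have H n k t : 0 <= t -> t <= b ->
    `|picard (n + k) t - picard n t| <= D *+ 2 / 2 ^+ n * expR (L * t).
  elim: n t => [|n IHn] t t0 tb.
    rewrite add0n expr0 divr1; apply: (@le_trans _ _ (D *+ 2)).
      by rewrite mulr2n (le_trans (ler_normB _ _))// lerD// pD.
    by rewrite ler_peMr// -expR0 ler_expR mulr_ge0// ltW.
  rewrite addSn /= opprD addrACA subrr addr0 exprSr invfM mulrA.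
  have lb s : s < t -> s <= b by move=> st; apply: ltW; exact: lt_le_trans tb.
  apply: contr.
  - by rewrite divr_ge0 ?exprn_ge0.
  - exact: cadlag_drift_integrable (picard_cadlag _).
  - exact: cadlag_drift_integrable (picard_cadlag _).
  - by move=> s _ _; split; exact: (picard_cadlag _ s).2.
  - by move=> s s0 st; split; apply: pD; rewrite ?lb// ltW.
  - by move=> s s0 st; apply: IHn; rewrite ?lb// ltW.
exists (D *+ 2 * expR (L * `|b|)) => n k t tb; rewrite mulrAC.
have A0 : 0 <= D *+ 2 / 2 ^+ n by rewrite divr_ge0 ?exprn_ge0.
have [t0|t0] := leP 0 t.
  apply: (le_trans (H n k t t0 tb)); rewrite ler_wpM2l// ler_expR ler_pM2l//.
  exact: le_trans (ler_norm b).
(* At negative times all iterates equal [z], so the estimate extends to the whole half-line up to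
   [b], as [uniform_limit_cadlag] requires. *)
have pz n' : picard n' t = z t by case: n' => [//|n'] /=; rewrite drift_lt0// add0r.
by rewrite !pz subrr normr0 mulr_ge0 ?expR_ge0.
Qed.

Definition picard_lim t : R := lim (picard n t @[n --> \oo]).

Lemma picard_cvg t : picard n t @[n --> \oo] --> picard_lim t.
Proof.
have [A pA] := picard_half_expn t.
by have [] := half_expn_cauchy (fun n k => pA n k t (lexx t)).
Qed.

Lemma picard_lim_dist b : exists A, forall n t, t <= b ->
  `|picard_lim t - picard n t| <= A / 2 ^+ n.
Proof.
have [A pA] := picard_half_expn b; exists A => n t tb.
by have [_] := half_expn_cauchy (fun n k => pA n k t tb); apply.
Qed.

Lemma picard_lim_cadlag : cadlag picard_lim.
Proof.
apply: (uniform_limit_cadlag picard_cadlag) => b e e0.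
have [A pA] := picard_lim_dist b.
have /cvgrPdist_lt/(_ _ e0)[n _ /(_ n (leqnn n))/=] := cvg_half_expn A.
rewrite sub0r normrN => nA; exists n => t tb; rewrite distrC.
exact: le_trans (pA n t tb) (le_trans (ler_norm _) (ltW nA)).
Qed.

(** The defect of the equation is the distance from the limit to iterate [n + 1] minus the
    difference of the drifts of the limit and of iterate [n]; both are of order [1 / 2 ^ n]. *)
Lemma picard_lim_solution t : 0 <= t ->
  picard_lim t = drift picard_lim t + z t.
Proof.
move=> t0; have [D D0 pD] := picard_bounded t.
have [D' D'0 lD] := @cadlag_bounded _ _ 0 t picard_lim_cadlag.
have [A pA] := picard_lim_dist t.
(* The contraction is taken on an interval that contains the iterates and the limit alike. *)
have DD0 : 0 < D + D' by exact: addr_gt0.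
have [L L0 contr] := drift_contraction DD0.
have A0 : 0 <= A.
  by have := pA 0%N t (lexx t); rewrite expr0 divr1; apply: le_trans.
apply/eqP; rewrite -subr_eq0; apply/eqP.
apply: (@half_expn_eq0 _ _ (A + A * expR (L * t))) => n.
have -> : picard_lim t - (drift picard_lim t + z t) =
    (picard_lim t - picard n.+1 t) - (drift picard_lim t - drift (picard n) t).
  by rewrite /=; ring.
have An : 0 <= A / 2 ^+ n by rewrite divr_ge0 ?exprn_ge0.
have le2 (r : R) : 0 <= r -> r / 2 <= r.
  by move=> r0; rewrite ler_pdivrMr// ler_peMr// ler1n.
apply: (le_trans (ler_normB _ _)); rewrite [leRHS]mulrDl; apply: lerD.
  by apply: (le_trans (pA n.+1 t (lexx t))); rewrite exprSr invfM mulrA le2.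
apply: (@le_trans _ _ (A / 2 ^+ n / 2 * expR (L * t))); last first.
  by rewrite [leRHS]mulrAC ler_wpM2r ?expR_ge0// le2.
apply: contr => //.
- exact: cadlag_drift_integrable picard_lim_cadlag.
- exact: cadlag_drift_integrable (picard_cadlag _).
- by move=> s _ _; split; [exact: (picard_lim_cadlag s).2|exact: (picard_cadlag _ s).2].
- move=> s s0 st; split.
    by apply: (le_trans (lD s (ltW s0) (ltW st))); rewrite lerDr ltW.
  by apply: (le_trans (pD n s (ltW s0) (ltW st))); rewrite lerDl ltW.
- move=> s s0 st; apply: (le_trans (pA n s (ltW st))).
  by rewrite ler_peMr// -expR0 ler_expR mulr_ge0 ?ltW.
Qed.

End PathwiseEquation.

(** * Extending paths from an interval to the whole line *)

Section ClampedPaths.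
Context {R : realType}.
Implicit Types (x : R -> R) (s t u : R).

Definition clamp (a b t : R) : R := Num.max a (Num.min t b).

Lemma clamp_id (a b t : R) : a <= t -> t <= b -> clamp a b t = t.
Proof. by move=> at_ tb; rewrite /clamp min_l// max_r. Qed.

Lemma clamp_left (a b t : R) : a <= b -> t <= a -> clamp a b t = a.
Proof. by move=> ab ta; rewrite /clamp min_l ?max_l// (le_trans ta). Qed.

Lemma clamp_right (a b t : R) : a <= b -> b <= t -> clamp a b t = b.
Proof. by move=> ab bt; rewrite /clamp min_r ?max_r. Qed.

Lemma clamp_le (a b t : R) : a <= b -> clamp a b t <= b.
Proof. by move=> ab; rewrite /clamp ge_max ab ge_min lexx orbT. Qed.

Let cvg_near_eq (F : set_system R) (FF : Filter F) x x' (l : R) :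
  (\forall u \near F, x u = x' u) -> x' u @[u --> F] --> l ->
  x u @[u --> F] --> l.
Proof.
move=> xx'; apply: cvg_trans; apply: near_eq_cvg.
by apply: filterS xx' => u ->.
Qed.

(** A path frozen outside [[a, b]] is locally constant there, so regularity inside the interval
    yields the global notion [cadlag]. *)
Lemma clamp_cadlag x (a b : R) : a <= b ->
  (forall t, a <= t -> t < b -> x u @[u --> t^'+] --> x t) ->
  (forall t, a < t -> t <= b -> cvg (x u @[u --> t^'-])) ->
  cadlag (fun t => x (clamp a b t)).
Proof.
move=> ab rx lx t; split.
  have [ta|at_] := ltP t a.
    apply: cvg_near_cst; near=> u.
    have ua : u < a by near: u; exact: nbhs_right_lt.
    by rewrite !clamp_left// ltW.
  have [tb|bt] := ltP t b; last first.
    apply: cvg_near_cst; near=> u.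
    have tu : t < u by near: u; exact: nbhs_right_gt.
    by rewrite !clamp_right// (le_trans bt)// ltW.
  rewrite (clamp_id at_ (ltW tb)); apply: cvg_near_eq (rx t at_ tb); near=> u.
  have tu : t < u by near: u; exact: nbhs_right_gt.
  have ub : u < b by near: u; exact: nbhs_right_lt.
  by rewrite clamp_id// ltW// (le_lt_trans at_).
have [ta|at_] := leP t a.
  apply/cvg_ex; exists (x a); apply: cvg_near_cst; near=> u.
  have ut : u < t by near: u; exact: nbhs_left_lt.
  by rewrite clamp_left// (le_trans _ ta)// ltW.
have [tb|bt] := leP t b.
  have /cvg_ex[l xl] := lx t at_ tb; apply/cvg_ex; exists l.
  apply: cvg_near_eq xl; near=> u.
  have ut : u < t by near: u; exact: nbhs_left_lt.
  have au : a < u by near: u; exact: nbhs_left_gt.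
  by rewrite clamp_id// ltW// (lt_le_trans ut).
apply/cvg_ex; exists (x b); apply: cvg_near_cst; near=> u.
have bu : b < u by near: u; exact: nbhs_left_gt.
by rewrite clamp_right// ltW.
Unshelve. all: by end_near. Qed.

Lemma llim_clamp x (a b t : R) : cvg (x u @[u --> t^'-]) -> a < t -> t <= b ->
  llim (fun u => x (clamp a b u)) t = llim x t.
Proof.
move=> cx at_ tb; apply: cvg_lim => //; apply: cvg_near_eq cx; near=> u.
have ut : u < t by near: u; exact: nbhs_left_lt.
have au : a < u by near: u; exact: nbhs_left_gt.
by rewrite clamp_id// ltW// (lt_le_trans ut).
Unshelve. all: by end_near. Qed.

(** Up to time [b] the extended path coincides with the path clamped to [[0, n]] for [n > b], so the
    approximation is exact. *)
Lemma positive_part_cadlag x :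
  (forall t, 0 <= t -> x u @[u --> t^'+] --> x t) ->
  (forall t, 0 < t -> cvg (x u @[u --> t^'-])) ->
  cadlag (fun t => x (Num.max 0 t)).
Proof.
move=> rx lx.
have cn (n : nat) : cadlag (fun t => x (clamp 0 n%:R t)).
  by apply: clamp_cadlag => // t t0 _; [exact: rx|exact: lx].
apply: (uniform_limit_cadlag cn) => b e e0; exists (Num.bound `|b|) => t tb.
rewrite /clamp min_l ?subrr ?normr0 ?ltW// (le_lt_trans tb)//.
by rewrite (le_lt_trans (ler_norm b))// archi_boundP.
Qed.

End ClampedPaths.

(** * Measurability of the solution at a fixed time *)

Section Adaptedness.
Context {R : realType} (mu : {measure set (measurableTypeR R) -> \bar R}).
Context (mu_fin : (mu `[0%R, +oo[%classic < +oo)%E).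
Context (f : R -> R) (mf : measurable_fun setT f).
Context (f_lip : forall r : R, 0 < r -> exists K : R, 0 < K /\
  forall x y : R, x \in `[- r, r] -> y \in `[- r, r] ->
  `|f x - f y| <= K * `|x - y|).
Context (f_growth : exists K eta : R, [/\ 0 < K, 0 < eta &
  forall x : R, `|f x| <= K + eta * `|x|]).
Context {d : measure_display} {T : measurableType d}.
Implicit Types (Y : R -> T -> R) (s t : R).

(* Clamping time to [-1, t] makes the process measurable at all times without
   changing its values and left limits on [0, t]. *)
Lemma drift_measurable Y t : (forall w, cadlag (Y ^~ w)) ->
  (forall s, s <= t -> measurable_fun setT (Y s)) ->
  measurable_fun setT (fun w => drift mu f (Y ^~ w) t).
Proof.
move=> cY mY; have [t0|t0] := ltP t 0.
  rewrite (_ : (fun w => _) = cst 0); first exact: measurable_cst.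
  by apply/funext => w; rewrite drift_lt0.
have m1t : -1 <= t by rewrite (le_trans _ t0)// lerN10.
pose Ys s w := Y (clamp (-1) t s) w.
have cYs w : cadlag (Ys ^~ w).
  by apply: (@clamp_cadlag _ (Y ^~ w)) => // s _ _; have [] := cY w s.
have mYs s : measurable_fun setT (Ys s) by apply: mY; exact: clamp_le.
have -> : (fun w => drift mu f (Y ^~ w) t) = (fun w =>
    fine (mu [set 0]) *
      (\int[@lebesgue_measure R]_(s in `[0%R, t]) f (llim (Ys ^~ w) s)) +
    \int[@lebesgue_measure R]_(s in `[0%R, t[) (m_minus mu (t - s) * f (Ys s w))).
  apply/funext => w; rewrite /drift /conv; congr (_ * _ + _).
    apply: eq_Rintegral => s; rewrite inE/= in_itv/= => /andP[s0 st].
    (* Clamping at -1 keeps this inequality strict at [s = 0]; clamping at 0 could alter the left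
       limit there. *)
    have s1 : -1 < s by rewrite (lt_le_trans _ s0)// ltrN10.
    by rewrite /= -(llim_clamp (cY w s).2 s1 st).
  apply: eq_Rintegral => s; rewrite inE/= in_itv/= => /andP[s0 st].
  by rewrite /= /Ys clamp_id ?(ltW st)// (le_trans _ s0)// lerN10.
apply: measurable_funD.
  apply: measurable_funM; first exact: measurable_cst.
  apply: (measurable_Rintegral_parameter
    (g := fun p : R * T => f (llim (Ys ^~ p.2) p.1))) => //.
  by apply: measurableT_comp => //; exact: left_limit_measurable.
apply: (measurable_Rintegral_parameter
  (g := fun p : R * T => m_minus mu (t - p.1) * f (Ys p.1 p.2))) => //.
apply: measurable_funM.
  apply: (measurableT_comp (f := m_minus mu) (g := fun p : R * T => t - p.1)).
    exact: cadlag_measurable (m_minus_cadlag mu_fin).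
  by apply: measurable_funB => //; exact: measurable_fst.
apply: measurableT_comp => //; apply: right_continuous_measurable => //.
by move=> w s; have [] := cYs w s.
Qed.

(** The sigma-algebra on [T] is arbitrary; choosing it to be [F t] turns this into adaptedness. *)
Lemma picard_lim_measurable Y t : (forall w, cadlag (Y ^~ w)) ->
  (forall s, s <= t -> measurable_fun setT (Y s)) ->
  measurable_fun setT (fun w => picard_lim mu f (Y ^~ w) t).
Proof.
move=> cY mY.
apply: (@measurable_fun_cvg _ _ _ _ (fun n w => picard mu f (Y ^~ w) n t)).
  (* The induction runs over all times up to [t] at once, since the drift at [s] depends on the path
     up to [s]. *)
  move=> n; suff H s : s <= t ->
      measurable_fun setT (fun w => picard mu f (Y ^~ w) n s) by exact: H.
  elim: n s => [|n IHn] s st /=.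
    exact: mY.
  apply: measurable_funD; last exact: mY.
  apply: (@drift_measurable (fun r w => picard mu f (Y ^~ w) n r)).
    by move=> w; exact: picard_cadlag.
  by move=> r rs; exact: (IHn r (le_trans rs st)).
by move=> w _; exact: picard_cvg.
Qed.

End Adaptedness.

(** * Measurability with respect to a sigma-algebra of the filtration *)

Section Filtrations.
Context {R : realType} {d : measure_display} {T : measurableType d}.
Implicit Types (G : set (set T)) (V : T -> R).

(** Equipping [T] with the sigma-algebra generated by [G], which is [G] itself, makes the general
    results on measurable functions available for each [F t]. *)
Lemma measurable_wrtP G V : sigma_algebra setT G ->
  measurable_wrt G V <-> measurable_fun setT (V : g_sigma_algebraType G -> R).
Proof.
move=> sG; have GE := sigma_algebra_id sG; split => [mV _ B mB|mV B mB].
  by rewrite setTI /measurable/= GE; exact: mV.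
by have := mV measurableT B mB; rewrite setTI /measurable/= GE.
Qed.

Lemma adapted_on_yE (F : R -> set (set T)) (X : R -> T -> R) :
  adapted_on F (cst +oo%E) X <-> forall t, 0 <= t -> measurable_wrt (F t) (X t).
Proof.
have E t B : [set w | (t%:E < cst +oo%E w)%E /\ B (X t w)] = X t @^-1` B.
  by apply/seteqP; split => w /=; [case|rewrite ltry].
by split => aX t t0 B mB; have := aX t t0 B mB; rewrite E.
Qed.

End Filtrations.

(** * Strong solutions of the delay equation: uniqueness, then a global solution *)

Theorem theorem3p2 (R : realType) (d : measure_display) (T : measurableType d)
    (P : probability T R) (F : R -> set (set T))
    (usualF : usual_conditions P F)
    (mu : {measure set (measurableTypeR R) -> \bar R})
    (mu_supp : mu `]-oo, 0[%classic = 0%E)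
    (mu_gt0 : (0 < mu `[0%R, +oo[%classic)%E)
    (mu_fin : (mu `[0%R, +oo[%classic < +oo)%E)
    (Z : R -> T -> R) (semiZ : cadlag_semimartingale P F Z)
    (x0 : T -> R) (mx0 : measurable_wrt (F 0) x0)
    (f : R -> R) (mf : measurable_fun setT f)
    (f_loc_lipschitz : forall r : R, 0 < r -> exists K : R, 0 < K /\
      forall x y : R, x \in `[- r, r] -> y \in `[- r, r] ->
        `|f x - f y| <= K * `|x - y|)
    (f_lin_growth : exists K eta : R, [/\ 0 < K, 0 < eta &
      forall x : R, `|f x| <= K + eta * `|x|]) :
  (exists (tau : T -> \bar R) (X : R -> T -> R),
    [/\ stopping_time F tau,
        strong_solution P F mu f Z x0 tau X &
        {ae P, forall w, tau w = +oo%E}]) /\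
  (forall (tau1 tau2 : T -> \bar R) (X1 X2 : R -> T -> R),
    stopping_time F tau1 -> stopping_time F tau2 ->
    strong_solution P F mu f Z x0 tau1 X1 ->
    strong_solution P F mu f Z x0 tau2 X2 ->
    null_on P (fun w : T => Order.min (tau1 w) (tau2 w))
      (fun (t : R) (w : T) => X1 t w - X2 t w)).
Proof.
have [[sF [FT monoF]] _ _ _] := usualF.
have [[adZ rZ lZ] _] := semiZ.
have rhsE X t w : solution_rhs mu f Z X t w = drift mu f (X ^~ w) t + Z t w.
  by [].
split; last first.
  move=> tau1 tau2 X1 X2 _ _ [_ [lX1 wd1] [_ rX1 _] eq1] [_ [lX2 wd2] [_ rX2 _] eq2].
  (* Outside the two exceptional null sets both equations hold at all times before the lifetimes;
     [w] is such an outcome and [b] a time before both lifetimes. *)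
  apply: filterS2 eq1 eq2 => w eq1 eq2 b b0; rewrite lt_min => /andP[b1 b2].
  have solE X tau : (b%:E < tau w)%E ->
      (forall t, 0 <= t -> (t%:E < tau w)%E ->
        X t w - x0 w - solution_rhs mu f Z X t w = 0) ->
      forall t, 0 <= t -> t <= b ->
        X t w = solution_rhs mu f Z X t w + x0 w.
    move=> btau eqX t t0 tb.
    have ttau : (t%:E < tau w)%E by apply: le_lt_trans btau; rewrite lee_fin.
    by apply/eqP; rewrite -subr_eq -subr_eq0 eqX.
  (* The solution has left limits by assumption, and inherits right continuity before [b] from
     [solution_rhs] through the equation; clamped to [[0, b]] it is cadlag, hence bounded. *)
  have bounded X tau : (b%:E < tau w)%E -> has_left_limits_on tau X ->
      right_continuous_on tau (solution_rhs mu f Z X) ->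
      (forall t, 0 <= t -> t <= b ->
        X t w = solution_rhs mu f Z X t w + x0 w) ->
      exists2 D, 0 < D & forall t, 0 <= t -> t <= b -> `|X t w| <= D.
    move=> btau lX rX eqX.
    have cX : cadlag (fun t => X (clamp 0 b t) w).
      apply: (@clamp_cadlag _ (X ^~ w)) => // t t0 tb.
        have ttau : (t%:E < tau w)%E by apply: lt_trans btau; rewrite lte_fin.
        rewrite (eqX t t0 (ltW tb)).
        apply: (@cvg_trans _ ((solution_rhs mu f Z X u w + x0 w) @[u --> t^'+])).
          apply: near_eq_cvg; near=> u.
          have tu : t < u by near: u; exact: nbhs_right_gt.
          have ub : u < b by near: u; exact: nbhs_right_lt.
          by rewrite /= -eqX// ltW// (le_lt_trans t0).
        by apply: cvgD; [exact: rX|exact: cvg_cst].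
      by apply: lX => //; apply: le_lt_trans btau; rewrite lee_fin.
    have [D D0 XD] := @cadlag_bounded _ _ 0 b cX; exists D => // t t0 tb.
    by have := XD t t0 tb; rewrite clamp_id.
  have {}eq1 := solE X1 tau1 b1 eq1; have {}eq2 := solE X2 tau2 b2 eq2.
  have [D1 D10 XD1] := bounded X1 tau1 b1 lX1 rX1 eq1.
  have [D2 D20 XD2] := bounded X2 tau2 b2 lX2 rX2 eq2.
  apply/eqP; rewrite subr_eq0; apply/eqP.
  apply: (@equation_unique _ mu mu_fin f f_loc_lipschitz (X1 ^~ w) (X2 ^~ w)
    (fun t => Z t w + x0 w) b (D1 + D2)) => //.
  - exact: addr_gt0.
  - move=> t t0 tb; rewrite !addrA -!rhsE; split; [| |exact: eq1|exact: eq2].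
      by apply: wd1 => //; apply: le_lt_trans b1; rewrite lee_fin.
    by apply: wd2 => //; apply: le_lt_trans b2; rewrite lee_fin.
  - move=> t t0 tb; split.
      by apply: lX1 => //; apply: le_lt_trans b1; rewrite lee_fin.
    by apply: lX2 => //; apply: le_lt_trans b2; rewrite lee_fin.
  - move=> t t0 tb; split.
      by apply: (le_trans (XD1 t t0 tb)); rewrite lerDl ltW.
    by apply: (le_trans (XD2 t t0 tb)); rewrite lerDr ltW.
(* The driving path is the noise plus the initial datum, frozen at its time 0 value for negative
   times. *)
pose Y t w := Z (Num.max 0 t) w + x0 w.
have cY w : cadlag (Y ^~ w).
  have cZ : cadlag (fun t => Z (Num.max 0 t) w).
    apply: (@positive_part_cadlag _ (Z ^~ w)) => t t0.
      by apply: rZ => //; exact: ltry.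
    by apply: lZ => //; exact: ltry.
  move=> t; have [zr zl] := cZ t; split.
    by apply: cvgD => //; exact: cvg_cst.
  by apply: is_cvgD => //; exact: is_cvg_cst.
pose X t w := picard_lim mu f (Y ^~ w) t.
have cX w : cadlag (X ^~ w) by exact: picard_lim_cadlag.
have XE t w : 0 <= t -> X t w = solution_rhs mu f Z X t w + x0 w.
  move=> t0; rewrite rhsE -addrA {1}/X.
  rewrite (picard_lim_solution mu_fin mf f_loc_lipschitz f_lin_growth (cY w) t0).
  by rewrite /Y max_r.
have rhsX t w : 0 <= t -> solution_rhs mu f Z X t w = X t w - x0 w.
  by move=> t0; rewrite XE// addrK.
have mx0t t : 0 <= t -> measurable_wrt (F t) x0.
  by move=> t0 B mB; apply: (monoF 0 t) => //; exact: mx0.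
(* For fixed [t] the outcome space carries [F t]; by monotonicity of the filtration, [Y s] is
   measurable for it at every [s <= t]. *)
have mX t : 0 <= t -> measurable_wrt (F t) (X t).
  move=> t0; apply/(measurable_wrtP _ (sF t t0)).
  apply: (@picard_lim_measurable _ mu mu_fin f mf f_loc_lipschitz f_lin_growth
    _ (g_sigma_algebraType (F t)) Y t cY) => s st.
  apply: measurable_funD; last exact/(measurable_wrtP _ (sF t t0))/mx0t.
  apply/(measurable_wrtP _ (sF t t0)) => B mB.
  have s0 : 0 <= Num.max 0 s by rewrite le_max lexx.
  apply: (monoF (Num.max 0 s) t) => //; first by rewrite ge_max t0.
  by have /adapted_on_yE := adZ; apply.
(* The path construction works for every outcome, so the lifetime is identically infinite. *)
exists (cst +oo%E), X; split.
- split => [w|t t0]; first exact: leey.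
  have [F0 _ _] := sF t t0; rewrite (_ : [set w | _] = set0)//.
  by apply/seteqP; split => w //=; rewrite leye_eq.
- split.
  + move=> t t0 B mB; apply: (FT t t0).
    by have aX : adapted_on F (cst +oo%E) X; [exact/adapted_on_yE|exact: aX].
  + split=> [w t t0 _|w t t0 _]; first exact: (cX w t).2.
    exact: (cadlag_drift_integrable mu_fin mf f_lin_growth t (cX w)).
  (* At nonnegative times the right-hand side equals [X - x0], so its regularity is that of [X]. *)
  + split.
    * apply/adapted_on_yE => t t0.
      have -> : solution_rhs mu f Z X t = (fun w => X t w - x0 w).
        by apply/funext => w; exact: rhsX.
      apply/(measurable_wrtP _ (sF t t0)); apply: measurable_funB.
        exact/(measurable_wrtP _ (sF t t0))/mX.
      exact/(measurable_wrtP _ (sF t t0))/mx0t.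
    * move=> w t t0 _; rewrite rhsX//.
      apply: (@cvg_trans _ ((X u w - x0 w) @[u --> t^'+])).
        apply: near_eq_cvg; near=> u.
        have tu : t < u by near: u; exact: nbhs_right_gt.
        by rewrite /= rhsX// (le_trans t0)// ltW.
      by apply: cvgB; [exact: (cX w t).1|exact: cvg_cst].
    * move=> w t t0 _; have [_ /cvg_ex[l Xl]] := cX w t.
      apply/cvg_ex; exists (l - x0 w).
      apply: (@cvg_trans _ ((X u w - x0 w) @[u --> t^'-])).
        apply: near_eq_cvg; near=> u.
        have u0 : 0 < u by near: u; exact: nbhs_left_gt.
        by rewrite /= rhsX// ltW.
      by apply: cvgB => //; exact: cvg_cst.
  + apply: aeW => w t t0 _; rewrite rhsX//; exact: subrr.
- exact: aeW.
Unshelve. all: by end_near. Qed.
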